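(* Let $n=4k+1$ (with $k$ an integer) be such that $17\le n<1000$, and let $F$ be a field of characteristic different from two. There exist maximal (with respect to inclusion) commutative subalgebras of the Grassmann algebra $G(n)$ over $F$ with dimension less than $3\cdot2^{n-2}$.
   Context: The Grassmann algebra $G(n)$ of rank $n$ over a field $F$ of characteristic $\ne2$ is the unital associative $F$-algebra generated by $v_1,\dots,v_n$ subject to $v_iv_j=-v_jv_i$ for all $1\le i,j\le n$; it has dimension $2^n$ over $F$. *)

(* Defs.v *)
From HB Require Import structures.
From mathcomp Require Import all_boot all_order all_algebra all_field.
Set Implicit Arguments.
Unset Strict Implicit.
Unset Printing Implicit Defensive.
Import GRing.Theory.
Local Open Scope ring_scope.

Definition anticommuting (F : fieldType) (n : nat) (B : algType F)
    (w : 'I_n -> B) : Prop :=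
  forall i j, w i * w j = - (w j * w i).

(* (A, v) is the unital associative F-algebra presented by the generators
   v_0, ..., v_(n-1) and the relations v_i v_j = - v_j v_i, i = j included.
   A presentation determines A, with its generators, up to a unique
   isomorphism.  That A is finite-dimensional is no restriction: when the
   characteristic is not 2, grassmann_exists below builds such an A, of
   dimension 2 ^ n. *)
Definition is_grassmann (F : fieldType) (n : nat) (A : falgType F)
    (v : 'I_n -> A) : Prop :=
  anticommuting v /\
  forall (B : algType F) (w : 'I_n -> B), anticommuting w ->
    exists f : {lrmorphism A -> B},
      (forall i, f (v i) = w i) /\
      (forall g : {lrmorphism A -> B}, (forall i, g (v i) = w i) -> g =1 f).

(* Maximality is with respect to inclusion among all commutative subalgebras.
   A subalgebra of type {aspace A} has an identity element, which in a Grassmann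
   algebra can only be 1, since its only idempotents are 0 and 1.  Allowing W
   to be closed under product without having an identity would change nothing:
   U contains 1, hence so does every W that contains U. *)
Definition maximal_commutative (F : fieldType) (A : falgType F)
    (U : {aspace A}) : Prop :=
  {in U &, commutative *%R} /\
  (forall W : {aspace A},
     {in W &, commutative *%R} -> (U <= W)%VS -> W = U :> {vspace A}).

(* The exterior algebra on the basis v_S, S a subset of 'I_n, where v_S is the
   increasing product of the v_i, i in S. *)
Definition grassmann (F : fieldType) (n : nat) : Type :=
  {ffun {set 'I_n} -> F^o}.

Section Grassmann.
Variables (F : fieldType) (n : nat).
Local Notation G := (grassmann F n).
Implicit Types (S T U : {set 'I_n}) (i j : 'I_n) (x y z : G).

HB.instance Definition _ := Vector.on G.

(* v_S v_T = gsign S T *: v_(S :|: T); gsign S T = 0 unless S and T are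
   disjoint. *)
Definition gsign1 i j : F := if i == j then 0 else (-1) ^+ (j < i)%N.
Definition gsign S T : F := \prod_(i in S) \prod_(j in T) gsign1 i j.

Definition gbase S : G := [ffun T => (T == S)%:R].
Definition gmul x y : G :=
  \sum_S \sum_T (x S * y T * gsign S T) *: gbase (S :|: T).

Lemma gbase_sum x : x = \sum_S x S *: gbase S.
Proof.
apply/ffunP=> T; rewrite sum_ffunE (bigD1 T) //= big1 => [|S neST].
  by rewrite !ffunE eqxx addr0 /GRing.scale /= mulr1.
by rewrite !ffunE eq_sym (negbTE neST) /GRing.scale /= mulr0.
Qed.

Lemma gmulDl : left_distributive gmul +%R.
Proof.
move=> x y z; rewrite /gmul -big_split; apply: eq_bigr => S _.
rewrite -big_split; apply: eq_bigr => T _ /=.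
by rewrite ffunE !mulrDl scalerDl.
Qed.

Lemma gmulDr : right_distributive gmul +%R.
Proof.
move=> x y z; rewrite /gmul -big_split; apply: eq_bigr => S _.
rewrite -big_split; apply: eq_bigr => T _ /=.
by rewrite ffunE mulrDr mulrDl scalerDl.
Qed.

Lemma gmulZl a x y : gmul (a *: x) y = a *: gmul x y.
Proof.
rewrite /gmul scaler_sumr; apply: eq_bigr => S _.
rewrite scaler_sumr; apply: eq_bigr => T _.
by rewrite ffunE scalerA /GRing.scale /= !mulrA.
Qed.

Lemma gmulZr a x y : gmul x (a *: y) = a *: gmul x y.
Proof.
rewrite /gmul scaler_sumr; apply: eq_bigr => S _.
rewrite scaler_sumr; apply: eq_bigr => T _.
by rewrite ffunE scalerA /GRing.scale /= !mulrA [x S * a]mulrC.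
Qed.

Lemma gmul_suml (I : finType) (h : I -> G) y :
  gmul (\sum_k h k) y = \sum_k gmul (h k) y.
Proof.
apply: (big_morph (gmul^~ y)) => [u v|]; first exact: gmulDl.
by rewrite -(scale0r (0 : G)) gmulZl !scale0r.
Qed.

Lemma gmul_sumr (I : finType) (h : I -> G) x :
  gmul x (\sum_k h k) = \sum_k gmul x (h k).
Proof.
apply: (big_morph (gmul x)) => [u v|]; first exact: gmulDr.
by rewrite -(scale0r (0 : G)) gmulZr !scale0r.
Qed.

Lemma gmul_base S T : gmul (gbase S) (gbase T) = gsign S T *: gbase (S :|: T).
Proof.
rewrite /gmul (bigD1 S) //= [X in _ + X]big1 ?addr0 => [|S' neS]; last first.
  by apply: big1 => T' _; rewrite !ffunE (negbTE neS) !mul0r scale0r.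
rewrite (bigD1 T) //= big1 ?addr0 => [|T' neT].
  by rewrite !ffunE !eqxx !mul1r.
by rewrite !ffunE (negbTE neT) mulr0 mul0r scale0r.
Qed.

Lemma gsign_disj S T i : i \in S -> i \in T -> gsign S T = 0.
Proof.
move=> iS iT; rewrite /gsign (bigD1 i) //= (bigD1 i) //= /gsign1 eqxx.
by rewrite !mul0r.
Qed.

Lemma gsignUr S T U : [disjoint T & U] ->
  gsign S (T :|: U) = gsign S T * gsign S U.
Proof.
move=> dTU; rewrite /gsign -big_split; apply: eq_bigr => i _ /=.
by rewrite (eq_bigl _ _ (fun i => in_setU i T U)) bigU.
Qed.

Lemma gsignUl S T U : [disjoint T & U] ->
  gsign (T :|: U) S = gsign T S * gsign U S.
Proof. by move=> d; rewrite /gsign (eq_bigl _ _ (fun i => in_setU i T U)) bigU. Qed.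

Lemma gsignA S T U :
  gsign S T * gsign (S :|: T) U = gsign T U * gsign S (T :|: U).
Proof.
have [dST|/pred0Pn[i /andP[/= iS iT]]] := boolP [disjoint S & T]; last first.
  rewrite (gsign_disj iS iT) (@gsign_disj S (T :|: U) i) ?mulr0 ?mul0r //.
  by rewrite inE iT.
have [dTU|/pred0Pn[i /andP[/= iT iU]]] := boolP [disjoint T & U]; last first.
  rewrite (gsign_disj iT iU) (@gsign_disj (S :|: T) U i) ?mulr0 ?mul0r //.
  by rewrite inE iT orbT.
by rewrite gsignUl // gsignUr // mulrA mulrC.
Qed.

Lemma gmul_suml_base x y : gmul x y = \sum_S x S *: gmul (gbase S) y.
Proof.
rewrite {1}[x]gbase_sum gmul_suml; apply: eq_bigr => S _; exact: gmulZl.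
Qed.

Lemma gmul_sumr_base x y : gmul x y = \sum_S y S *: gmul x (gbase S).
Proof.
rewrite {1}[y]gbase_sum gmul_sumr; apply: eq_bigr => S _; exact: gmulZr.
Qed.

Lemma gmulA : associative gmul.
Proof.
move=> x y z.
rewrite (gmul_suml_base x (gmul y z)) (gmul_suml_base x y) gmul_suml.
apply: eq_bigr => S _; rewrite [RHS]gmulZl; congr (_ *: _).
rewrite (gmul_suml_base y z) gmul_sumr (gmul_sumr_base (gbase S)) gmul_suml.
apply: eq_bigr => T _; rewrite [LHS]gmulZr [RHS]gmulZl; congr (_ *: _).
rewrite (gmul_sumr_base (gbase T)) gmul_sumr [RHS]gmul_sumr_base.
apply: eq_bigr => U _; rewrite [LHS]gmulZr; congr (_ *: _).
by rewrite !gmul_base gmulZl gmulZr !gmul_base !scalerA setUA gsignA.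
Qed.

Lemma gmul1l : left_id (gbase set0) gmul.
Proof.
move=> x; rewrite gmul_sumr_base [RHS]gbase_sum; apply: eq_bigr => S _.
by rewrite gmul_base set0U /gsign big_set0 scale1r.
Qed.

Lemma gmul1r : right_id (gbase set0) gmul.
Proof.
move=> x; rewrite gmul_suml_base [RHS]gbase_sum; apply: eq_bigr => S _.
rewrite gmul_base setU0 /gsign big1 ?scale1r // => i _.
by rewrite big_set0.
Qed.

Lemma gbase0_neq0 : gbase set0 != 0.
Proof. by apply/eqP=> /ffunP/(_ set0)/eqP; rewrite !ffunE eqxx oner_eq0. Qed.

HB.instance Definition _ := GRing.Zmodule_isNzRing.Build G
  gmulA gmul1l gmul1r gmulDl gmulDr gbase0_neq0.
HB.instance Definition _ := GRing.Lmodule_isLalgebra.Build F G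
  (fun a x y => esym (gmulZl a x y)).
HB.instance Definition _ := GRing.Lalgebra_isAlgebra.Build F G
  (fun a x y => esym (gmulZr a x y)).
HB.instance Definition _ := Algebra_isFalgebra.Build F G.

Definition ggen i : G := gbase [set i].

Lemma gbaseM S T : gbase S * gbase T = gsign S T *: gbase (S :|: T).
Proof. exact: gmul_base. Qed.

Lemma gsign11 i j : gsign [set i] [set j] = gsign1 i j.
Proof. by rewrite /gsign !big_set1. Qed.

Lemma ggen_anticommuting : anticommuting ggen.
Proof.
move=> i j; rewrite /ggen !gbaseM !gsign11 setUC -scaleNr; congr (_ *: _).
rewrite /gsign1 eq_sym; case: eqVneq => [|neij]; first by rewrite oppr0.
by rewrite -val_eqE in neij; case: ltngtP neij => //=; rewrite expr1 ?opprK.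
Qed.

(* The restriction to sorted r is what an induction over index_enum 'I_n
   needs. *)
Local Notation lt_ord := (fun i j : 'I_n => (i < j)%N).

Lemma lt_ord_trans : transitive lt_ord.
Proof. by move=> j i k; apply: ltn_trans. Qed.

Lemma index_enum_sorted : sorted lt_ord (index_enum 'I_n).
Proof.
rewrite -[index_enum _]/(Finite.enum _) -enumT.
rewrite -(@sorted_map _ _ (val : 'I_n -> nat) ltn) val_enum_ord.
exact: iota_ltn_sorted.
Qed.

Lemma gbase_prod_seq (r : seq 'I_n) S : sorted lt_ord r ->
  \prod_(i <- r | i \in S) ggen i = gbase [set i in S | i \in r].
Proof.
elim: r => [|i r IH] /= srt.
  by rewrite big_nil; congr gbase; apply/setP=> j; rewrite !inE andbF.
have /allP lti := order_path_min lt_ord_trans srt.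
rewrite big_cons (IH (path_sorted srt)); case: ifPn => iS; last first.
  congr gbase; apply/setP=> j; rewrite !inE.
  by case: (eqVneq j i) => // ->; rewrite (negbTE iS).
rewrite /ggen gbaseM /gsign big_set1 big1 ?scale1r => [|j]; last first.
  rewrite inE => /andP[_ /lti ltij]; rewrite /gsign1 -val_eqE ltn_eqF //.
  by rewrite ltnNge ltnW.
congr gbase; apply/setP=> j; rewrite !inE.
by case: (eqVneq j i) => [->|]; rewrite ?iS.
Qed.

Lemma gbase_prod S : gbase S = \prod_(i in S) ggen i.
Proof.
rewrite gbase_prod_seq ?index_enum_sorted //; congr gbase.
by apply/setP=> i; rewrite inE mem_index_enum andbT.
Qed.

Section Lift.
Variables (F2 : 2%N \notin [pchar F]) (B : algType F) (w : 'I_n -> B).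
Hypothesis w_anti : anticommuting w.

Lemma anticommuting_sqr i : w i * w i = 0.
Proof.
have two0 : (2 : F) != 0 by move: F2; rewrite inE.
apply/eqP; rewrite -(can_eq (scalerK two0)) scaler0.
by rewrite scaler_nat mulr2n {1}w_anti addNr.
Qed.

Lemma gen_mul_prod (r : seq 'I_n) i T : sorted lt_ord r -> i \in r ->
  w i * (\prod_(j <- r | j \in T) w j) =
  (\prod_(j <- r | j \in T) gsign1 i j) *: \prod_(j <- r | j \in i |: T) w j.
Proof.
elim: r => [|j r IH] //= srt.
have /allP ltj := order_path_min lt_ord_trans srt.
rewrite inE !big_cons in_setU1; case: (eqVneq i j) ltj => [<-|neij] ltj /=.
  move=> _.
  case: ifP => iT.
    by rewrite mulrA anticommuting_sqr /gsign1 eqxx !mul0r scale0r.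
  rewrite [X in X *: _]big_seq_cond [X in X *: _]big1 => [|k /andP[/ltj ltik _]].
    rewrite scale1r; congr (_ * _); rewrite big_seq_cond [RHS]big_seq_cond.
    apply: eq_bigl => k; rewrite in_setU1; case: eqVneq => [->|//].
    by case: (boolP (i \in r)) => // /ltj; rewrite ltnn.
  by rewrite /gsign1 -val_eqE ltn_eqF // ltnNge ltnW.
move=> ir; have ltji := ltj i ir.
case: ifP => jT; last exact: IH (path_sorted srt) ir.
rewrite mulrA w_anti mulNr -mulrA IH ?(path_sorted srt) //.
by rewrite {2}/gsign1 (negbTE neij) ltji expr1 mulN1r scaleNr scalerAr.
Qed.

Definition gprod S : B := \prod_(i in S) w i.

Lemma gen_gprod i T : w i * gprod T = gsign [set i] T *: gprod (i |: T).
Proof.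
rewrite /gprod /gsign big_set1; apply: gen_mul_prod; last exact: mem_index_enum.
exact: index_enum_sorted.
Qed.

Lemma prod_mul_gprod (r : seq 'I_n) S T : sorted lt_ord r ->
  (\prod_(i <- r | i \in S) w i) * gprod T =
  gsign [set i in S | i \in r] T *: gprod ([set i in S | i \in r] :|: T).
Proof.
elim: r => [|i r IH] /= srt.
  have -> : [set i in S | i \in [::]] = set0.
    by apply/setP=> j; rewrite !inE andbF.
  by rewrite big_nil mul1r set0U /gsign big_set0 scale1r.
have /allP lti := order_path_min lt_ord_trans srt.
rewrite big_cons; case: ifPn => iS; last first.
  rewrite IH ?(path_sorted srt) //.
  have -> // : [set j in S | j \in i :: r] = [set j in S | j \in r].
  apply/setP=> j; rewrite !inE.
  by case: (eqVneq j i) => // ->; rewrite (negbTE iS).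
rewrite -mulrA IH ?(path_sorted srt) //; set S' := [set j in S | j \in r].
have -> : [set j in S | j \in i :: r] = [set i] :|: S'.
  by apply/setP=> j; rewrite !inE; case: (eqVneq j i) => [->|]; rewrite ?iS.
have iS' : i \notin S'.
  by rewrite inE; apply/negP=> /andP[_ /lti]; rewrite ltnn.
have i1 : gsign [set i] S' = 1.
  rewrite /gsign big_set1 big1 // => j; rewrite inE => /andP[_ /lti ltij].
  by rewrite /gsign1 -val_eqE ltn_eqF // ltnNge ltnW.
rewrite -scalerAr gen_gprod scalerA -setUA; congr (_ *: _).
by rewrite -gsignA i1 mul1r.
Qed.

Lemma gprodM S T : gprod S * gprod T = gsign S T *: gprod (S :|: T).
Proof.
rewrite {1}/gprod prod_mul_gprod ?index_enum_sorted //.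
have -> // : [set i in S | i \in index_enum 'I_n] = S.
by apply/setP=> i; rewrite inE mem_index_enum andbT.
Qed.

Definition glift x : B := \sum_S x S *: gprod S.

Lemma glift_is_linear : linear glift.
Proof.
move=> a x y; rewrite /glift scaler_sumr -big_split; apply: eq_bigr => S _ /=.
by rewrite !ffunE scalerDl scalerA.
Qed.

HB.instance Definition _ := GRing.isLinear.Build F G B _ glift glift_is_linear.

Lemma glift_base S : glift (gbase S) = gprod S.
Proof.
rewrite /glift (bigD1 S) //= big1 ?addr0 ?ffunE ?eqxx ?scale1r // => T neT.
by rewrite ffunE (negbTE neT) scale0r.
Qed.

Lemma glift_is_monoid_morphism : monoid_morphism glift.
Proof.
split=> [|x y]; first by rewrite [LHS](glift_base set0) /gprod big_set0.
rewrite [x]gbase_sum [y]gbase_sum mulr_suml !linear_sum mulr_suml.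
apply: eq_bigr => S _; rewrite mulr_sumr !linear_sum mulr_sumr.
apply: eq_bigr => T _.
rewrite -scalerAl -scalerAr !linearZ /= !glift_base -scalerAl -scalerAr.
by rewrite gbaseM [glift (_ *: _)]linearZ /= glift_base gprodM.
Qed.

HB.instance Definition _ :=
  GRing.isMonoidMorphism.Build G B glift glift_is_monoid_morphism.

Lemma glift_universal : exists f : {lrmorphism G -> B},
  (forall i, f (ggen i) = w i) /\
  (forall g : {lrmorphism G -> B}, (forall i, g (ggen i) = w i) -> g =1 f).
Proof.
exists glift; split=> [i|g gw x].
  by rewrite [LHS](glift_base [set i]) /gprod big_set1.
rewrite [x]gbase_sum !linear_sum; apply: eq_bigr => S _.
rewrite !linearZ /= glift_base gbase_prod rmorph_prod; congr (_ *: _).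
by apply: eq_bigr => i _; exact: gw.
Qed.

End Lift.

Lemma ggen_is_grassmann : 2%N \notin [pchar F] -> is_grassmann ggen.
Proof.
by move=> F2; split=> [|B w]; [exact: ggen_anticommuting | exact: glift_universal].
Qed.

Lemma dim_grassmann : \dim {: G} = (2 ^ n)%N.
Proof.
by rewrite dimvf /dim /= -cardsT -powersetT card_powerset cardsT card_ord muln1.
Qed.

End Grassmann.

Lemma grassmann_exists (F : fieldType) (n : nat) : 2%N \notin [pchar F] ->
  exists (A : falgType F) (v : 'I_n -> A),
    is_grassmann v /\ \dim {: A} = (2 ^ n)%N.
Proof.
move=> F2; exists (grassmann F n), (@ggen F n); split.
  exact: ggen_is_grassmann.
exact: dim_grassmann.
Qed.

(* Main.v *)
Require Import Defs.
From mathcomp Require Import all_boot all_order all_algebra all_field.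
From mathcomp Require Import zify.
Import GRing.Theory.
Local Open Scope ring_scope.

(** Even elements are central, and two odd elements commute only if their
    product is 0.  Hence a maximal commutative subalgebra is the even part, of
    dimension 2 ^ (n - 1), plus a space of odd elements that equals its own
    annihilator among the odd elements.  Such a space is spanned by the monomials
    v_S, S in H, as soon as H is a family of odd subsets of the n indices that
    pairwise meet and to which no odd set can be added: a set outside H misses
    some B in H, and multiplying by v_B detects its coefficient
    ([span_maximal]).  It remains to find such a family H, for n = 4k + 1, with
    fewer than 2 ^ (n - 2) members.

    All odd sets with at least 2k + 1 elements form such a family, but there are
    (2 ^ (4k) + 'C(4k, 2k)) / 2 of them, slightly too many.  Its smallest sets are
    therefore traded for sets of size 2k - 1.  Fix a point p and a family U of
    2k-sets containing p.  Remove the complements of the members of U, and add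
    the interior of U, the sets of size 2k - 1 containing p all of whose
    one-point extensions lie in U.  If U is covered by its interior, that is, if U
    is an upper shadow, the result is again maximal ([exchange_maximal]), and it
    has #|U| - #|interior of U| fewer members.  So U must be an upper shadow with
    few generators which is larger than its interior by more than 'C(4k, 2k) / 2.

    To get one, give the points weights in a group M of order 5, such that p is the
    only point of its weight and the four other weights are taken k times each.
    Let U_c be the upper shadow of the (2k - 1)-sets that contain p and have
    weight c.  A 2k-set through p lies in U_c for about four of the five values
    of c, since any of its points other than p may be removed, and these have four
    different weights unless one weight is missed ([shadow_count]).  A
    (2k - 1)-set lies in the interior of U_c only when c is its own weight, unless
    it contains all points of some weight: otherwise the four values other than the
    weight of p would be invariant under a nonzero translation of M
    ([interior_weight]).  The exceptional sets are counted by
    multiples of 'C(3k, k + 1) and 'C(3k, k - 2), which are small compared with 'C(4k, 2k).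
    On average over c the difference #|U_c| - #|interior of U_c| is therefore
    about 4/5 'C(4k, 2k - 1) - 1/5 'C(4k, 2k - 2), and for k >= 4 some c
    exceeds 'C(4k, 2k) / 2 ([bin_margin], [exists_good_shadow]). *)

Set Implicit Arguments.
Unset Strict Implicit.
Unset Printing Implicit Defensive.

(** * Combinatorics of odd intersecting families *)

Local Open Scope nat_scope.

Definition evens (T : finType) := [set S : {set T} | ~~ odd #|S|].

Definition maximal_odd_intersecting (T : finType) (H : {set {set T}}) : Prop :=
  [/\ {in H, forall S : {set T}, odd #|S|},
      {in H &, forall S B : {set T}, ~~ [disjoint S & B]} &
      forall S : {set T}, odd #|S| -> S \notin H ->
        exists2 B, B \in H & [disjoint S & B]].

Section Counting.
Variable T : finType.
Implicit Types (A B C D P : {set T}) (x p : T).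

Lemma card_supersets P D j : P \subset D ->
  #|[set C : {set T} | [&& P \subset C, C \subset D & #|C| == #|P| + j]]|
  = 'C(#|D| - #|P|, j).
Proof.
move=> PD; rewrite -(setIidPr PD) -cardsD (setIidPr PD) -cards_draws.
rewrite -[RHS](@card_in_imset _ _ (fun B => P :|: B)); last first.
  move=> B C; rewrite !inE !subsetD => /andP[/andP[_ dB] _] /andP[/andP[_ dC] _] eqU.
  rewrite -(setDidPl dB) -(setDidPl dC).
  by have := congr1 (fun X => X :\: P) eqU; rewrite /= !setDUl setDv !set0U.
apply: eq_card => C; rewrite inE; apply/idP/imsetP => [/and3P[PC CD /eqP cC]|[B]].
  exists (C :\: P).
    by rewrite inE setSD //= cardsD (setIidPr PC) cC addKn.
  by rewrite setUC setDE setUIl [~: P :|: P]setUC setUCr setIT (setUidPl PC).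
rewrite inE subsetD => /andP[/andP[BD dBP] /eqP cB] ->.
rewrite subsetUl subUset PD BD cardsU setIC (disjoint_setI0 dBP) cards0 subn0 cB.
by rewrite eqxx.
Qed.

(** The parity of a set tells whether it contains p once its other elements are
    known, so sets of one parity correspond to the subsets of the complement
    of p. *)
Lemma setD1_odd_inj p A B : odd #|A| = odd #|B| -> A :\ p = B :\ p -> A = B.
Proof.
move=> eqo eqD; have pAB : (p \in A) = (p \in B).
  move: eqo; rewrite (cardsD1 p A) (cardsD1 p B) eqD !oddD => /addIb.
  by do 2!case: (p \in _).
apply/setP=> x; have [->//|nexp] := eqVneq x p.
by have /setP/(_ x) := eqD; rewrite !inE nexp.
Qed.

Lemma card_evens p : #|evens T| <= 2 ^ #|T|.-1.
Proof.
have cp : #|[set~ p]| = #|T|.-1 by rewrite cardsC1.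
rewrite -cp -card_powerset -(@card_in_imset _ _ (fun A => A :\ p)).
  by apply/subset_leq_card/subsetP=> _ /imsetP[A _ ->]; rewrite powersetE subsetDr.
by move=> A B; rewrite !inE => /negbTE oA /negbTE oB; apply: setD1_odd_inj; rewrite oA.
Qed.

(** Removing p turns these odd sets into subsets with at least 2k elements of the
    4k other points; complementation there pairs the subsets above the middle layer
    with those below it, and the middle layer is counted twice. *)
Lemma card_large_odd p k : #|T| = (4 * k).+1 ->
  2 * #|[set A : {set T} | odd #|A| && (2 * k < #|A|)]| <= 2 ^ (4 * k) + 'C(4 * k, 2 * k).
Proof.
move=> cT; set L := [set A | _]; pose D : {set T} := [set~ p].
have cD : #|D| = 4 * k by rewrite cardsC1 cT.
pose X := [set B in powerset D | 2 * k <= #|B|].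
pose Y := [set B in powerset D | #|B| <= 2 * k].
have LX : #|L| <= #|X|.
  rewrite -(@card_in_imset _ _ (fun A => A :\ p) L); last first.
    move=> A B; rewrite !inE => /andP[oA _] /andP[oB _].
    by apply: setD1_odd_inj; rewrite oA oB.
  apply/subset_leq_card/subsetP=> A' /imsetP[A]; rewrite !inE => /andP[_ lA] ->.
  by rewrite subsetDr /=; move: lA; rewrite (cardsD1 p A); case: (p \in A); lia.
have XY : #|X| <= #|Y|.
  rewrite -(@card_in_imset _ _ (fun B => D :\: B) X); last first.
    move=> A B; rewrite !inE => /andP[AD _] /andP[BD _] eqD.
    rewrite -(setIidPr AD) -(setIidPr BD) -[D :&: A]set0U -[D :&: B]set0U.
    by rewrite -(setDv D) -!setDDr eqD.
  apply/subset_leq_card/subsetP=> B' /imsetP[B]; rewrite !inE => /andP[BD lB] ->.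
  by rewrite subsetDl cardsD (setIidPr BD) cD /=; lia.
have UX : X :|: Y = powerset D.
  by apply/setP=> B; rewrite !inE -andb_orr leq_total andbT.
have IX : X :&: Y = [set B : {set T} | B \subset D & #|B| == 2 * k].
  by apply/setP=> B; rewrite !inE andbACA andbb eqn_leq; congr (_ && _); rewrite andbC.
have := cardsU X Y; have := subset_leq_card (subsetIl X Y).
by rewrite IX UX cards_draws card_powerset cD; lia.
Qed.

End Counting.

Lemma double_count (I J : finType) (P : pred I) (Q : pred J) (r : I -> J -> bool) :
  \sum_(i | P i) #|[set j | Q j && r i j]| = \sum_(j | Q j) #|[set i | P i && r i j]|.
Proof.
have cardE (K : finType) (R s : pred K) : #|[set x | R x && s x]| = \sum_(x | R x) s x.
  by rewrite -sum1dep_card big_mkcondr.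
under eq_bigr do rewrite cardE; rewrite exchange_big /=.
by under [RHS]eq_bigr do rewrite cardE.
Qed.

(** * Replacing the lowest layer of the majority family *)

Section Exchange.
Variables (T : finType) (k : nat) (p : T).
Hypotheses (k_gt0 : 0 < k) (cT : #|T| = (4 * k).+1).
Implicit Types (A B C D : {set T}) (U : {set {set T}}) (x : T).

Definition shadow_interior U : {set {set T}} :=
  [set A : {set T} | [&& p \in A, #|A| == (2 * k).-1 &
                         [forall x, (x \notin A) ==> (x |: A \in U)]]].

(** The last condition only concerns the sets A with 2k + 1 elements, as the members
    of U are meant to have 2k. *)
Definition exchange U : {set {set T}} :=
  [set A : {set T} | [&& odd #|A|, 2 * k < #|A| & ~: A \notin U]] :|: shadow_interior U.

Variable U : {set {set T}}.
Hypothesis U_level : {in U, forall C : {set T}, p \in C /\ #|C| = 2 * k}.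
Hypothesis U_shadow : {in U, forall C : {set T},
  exists2 x, x \in C & C :\ x \in shadow_interior U}.

(** A (2k - 1)-set A and a (2k + 1)-set B are disjoint exactly when the complement
    of B extends A by one point.  So the interior sets meet everything that is
    kept, any other (2k - 1)-set misses something that is kept, and a removed set
    misses the interior set that [U_shadow] provides below its complement.  Two
    interior sets meet in p. *)
Lemma exchange_maximal : maximal_odd_intersecting (exchange U).
Proof.
have meetIL A B : A \in shadow_interior U -> odd #|B| -> 2 * k < #|B| ->
    ~: B \notin U -> ~~ [disjoint A & B].
  rewrite inE => /and3P[pA /eqP cA /forallP Aint] oB cB BU; apply/negP=> dAB.
  have AB : A \subset ~: B by rewrite -disjoints_subset.
  have := cardsC B; rewrite cT => cBC; have := subset_leq_card AB => leAB.
  have [x xB xA] : exists2 x, x \in ~: B & x \notin A.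
    by apply/subsetPn; apply/negP => /subset_leq_card; lia.
  have xAU := implyP (Aint x) xA; case/negP: BU; rewrite (_ : ~: B = x |: A) //.
  apply/esym/eqP; rewrite eqEcard subUset sub1set xB AB cardsU1 xA cA /=; lia.
split=> [S|S B|S oddS].
- rewrite !inE => /orP[/and3P[]//|/and3P[_ /eqP-> _]]; lia.
- rewrite !in_setU !inE.
  case/orP=> [/and3P[oS lS SU]|SI]; case/orP=> [/and3P[oB lB BU]|BI].
  + apply/negP; rewrite disjoints_subset => /subset_leq_card.
    by have := cardsC B; lia.
  + by rewrite disjoint_sym meetIL // inE.
  + by rewrite meetIL // inE.
  + case/andP: SI => pS _; case/andP: BI => pB _.
    by apply/pred0Pn; exists p; rewrite /= pS pB.
rewrite in_setU negb_or inE oddS /= => /andP[SL SI].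
have cC := cardsC S; have [ltkS|leSk] := ltnP (2 * k) #|S|.
  move: SL; rewrite ltkS negbK => SU.
  have [x xS SxI] := U_shadow SU; exists (~: S :\ x); first by rewrite in_setU SxI orbT.
  by rewrite disjoints_subset setCD setCK subsetUl.
have inL B : #|B| = (2 * k).+1 -> ~: B \notin U -> B \in exchange U.
  by move=> cB BU; rewrite in_setU inE BU cB; lia.
have outer x : x \notin S -> #|S| = (2 * k).-1 -> x |: S \notin U ->
    exists2 B, B \in exchange U & [disjoint S & B].
  move=> xS cS xSU; exists (~: (x |: S)).
    by apply: inL; rewrite ?setCK //; have := cardsC (x |: S); rewrite cardsU1 xS cS; lia.
  by rewrite disjoints_subset setCK subsetUr.
have [cS|ltS] := eqVneq #|S| (2 * k).-1.
  have [pS|pS] := boolP (p \in S).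
    move: SI; rewrite inE pS cS eqxx /= negb_forall => /existsP[x].
    by rewrite negb_imply => /andP[xS]; apply: outer.
  (* S misses p and another point x, so x |: S misses p as well: not in U. *)
  have [x xC xp] : exists2 x, x \in ~: S & x \notin [set p].
    by apply/subsetPn; apply/negP => /subset_leq_card; rewrite cards1; lia.
  apply: (outer x) => //; first by rewrite inE in xC.
  apply/negP=> /U_level[]; rewrite !inE (negbTE pS) orbF => /eqP px.
  by rewrite px inE eqxx in xp.
(* Only #|S| <= 2k - 3 is left; sets of size 2k + 3 are never removed. *)
have : 0 < #|[set B : {set T} | B \subset ~: S & #|B| == (2 * k).+3]|.
  by rewrite cards_draws bin_gt0; lia.
case/card_gt0P=> B; rewrite inE => /andP[BS /eqP cB]; exists B.
  rewrite in_setU inE cB; apply/orP; left; apply/and3P; split; try lia.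
  by apply/negP=> /U_level[_]; have := cardsC B; lia.
by rewrite disjoint_sym disjoints_subset.
Qed.

Lemma card_exchange :
  2 * #|exchange U| + 2 * #|U| <=
    2 ^ (4 * k) + 'C(4 * k, 2 * k) + 2 * #|shadow_interior U|.
Proof.
set L := [set A : {set T} | odd #|A| && (2 * k < #|A|)].
have sub : [set ~: C | C in U] \subset L.
  apply/subsetP=> _ /imsetP[C CU ->]; have [_ cC] := U_level CU.
  by rewrite inE; have := cardsC C; rewrite cT cC; lia.
have eqL : [set A : {set T} | [&& odd #|A|, 2 * k < #|A| & ~: A \notin U]] =
    L :\: [set ~: C | C in U].
  apply/setP=> A; rewrite !inE andbA [RHS]andbC; congr (_ && ~~ _).
  by rewrite -{2}[A]setCK (mem_imset _ _ (@setC_inj _)).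
have := @card_large_odd T p k cT; rewrite -/L => cL.
have cU : #|[set ~: C | C in U]| = #|U| by rewrite card_imset //; exact: setC_inj.
have leUL : #|U| <= #|L| by rewrite -cU subset_leq_card.
have cD : #|L :\: [set ~: C | C in U]| = #|L| - #|U| by rewrite cardsD (setIidPr sub) cU.
have : #|exchange U| <= (#|L| - #|U|) + #|shadow_interior U|.
  by rewrite -cD /exchange eqL cardsU leq_subr.
lia.
Qed.

End Exchange.

(** * Binomial estimates *)

(** Two neighbouring binomials satisfy [a * x = b * y]; a bound on a / b then bounds
    y / x. *)
Lemma leq_ratio a b c d x y : 0 < b -> a * x = b * y -> d * a <= c * b -> d * y <= c * x.
Proof.
move=> b0 axby ab; rewrite -(leq_pmul2l b0).
have -> : b * (d * y) = d * a * x by rewrite -mulnA axby mulnCA.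
by rewrite mulnA [b * c]mulnC leq_mul2r ab orbT.
Qed.

Lemma central_bin_growth m : 2 <= m -> 10 * 'C(m.*2, m) <= 3 * 'C(m.*2.+2, m.+1).
Proof.
move=> m2; have e1 := mul_bin_diag m.*2.+1 m; have e2 := mul_bin_down m.*2.+2 m.+1.
rewrite /= in e1 e2.
have h1 : 5 * 'C(m.*2, m) <= 3 * 'C(m.*2.+1, m.+1).
  by apply: (@leq_ratio m.+1 m.*2.+1) => //; lia.
have h2 : 2 * 'C(m.*2.+1, m.+1) <= 1 * 'C(m.*2.+2, m.+1).
  by apply: (@leq_ratio (m.*2.+2 - m.+1) m.*2.+2) => //; lia.
lia.
Qed.

(** These growth rates tend to 27 / 4, that of 'C(4k, 2k) to 16.  The bound 10
    separates the two, and leaves room to estimate each of the three steps from 3k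
    to 3k + 3 by a constant ratio. *)
Lemma small_bin_growth k : 4 <= k ->
  'C(3 * k.+1, k.+2) <= 10 * 'C(3 * k, k.+1) /\
  'C(3 * k.+1, k.-1) <= 10 * 'C(3 * k, k.-2).
Proof.
move=> k4; have -> : 3 * k.+1 = (3 * k).+3 by lia.
have [n nE] : {n | n = 3 * k} by exists (3 * k).
rewrite -nE.
have d0 := mul_bin_diag n.+1 k.+1; have d1 := mul_bin_down n.+2 k.+2.
have d2 := mul_bin_down n.+3 k.+2.
have e0 := mul_bin_diag n.+1 k.-2; have e1 := mul_bin_down n.+2 k.-1.
have e2 := mul_bin_down n.+3 k.-1.
have kE : k.-2.+1 = k.-1 by lia.
rewrite kE in e0; rewrite /= in d0 d1 d2 e0 e1 e2.
split.
  have h0 : 1 * 'C(n.+1, k.+2) <= 3 * 'C(n, k.+1) by apply: leq_ratio d0 _; lia.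
  have h1 : 5 * 'C(n.+2, k.+2) <= 9 * 'C(n.+1, k.+2) by apply: leq_ratio d1 _; lia.
  have h2 : 5 * 'C(n.+3, k.+2) <= 9 * 'C(n.+2, k.+2) by apply: leq_ratio d2 _; lia.
  lia.
have h0 : 3 * 'C(n.+1, k.-1) <= 13 * 'C(n, k.-2) by apply: leq_ratio e0 _; lia.
have h1 : 2 * 'C(n.+2, k.-1) <= 3 * 'C(n.+1, k.-1) by apply: leq_ratio e1 _; lia.
have h2 : 2 * 'C(n.+3, k.-1) <= 3 * 'C(n.+2, k.-1) by apply: leq_ratio e2 _; lia.
lia.
Qed.

(** At k = 4 this is 12672 <= 12870; from k to k + 1 the left side grows at most
    tenfold, the right side at least (10 / 3) ^ 2 times. *)
Lemma small_bin_bound k : 4 <= k ->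
  12 * ('C(3 * k, k.+1) + 4 * 'C(3 * k, k.-2)) <= 'C(4 * k, 2 * k).
Proof.
elim: k => // k IH; rewrite leq_eqVlt => /orP[/eqP <- //|k4].
have [s1 s2] := small_bin_growth k4; have {IH} := IH k4.
have g1 := @central_bin_growth k.*2; have g2 := @central_bin_growth k.*2.+1.
have -> : 4 * k = k.*2.*2 by lia.
have -> : 2 * k = k.*2 by lia.
have -> : 4 * k.+1 = k.*2.+1.*2.+2 by lia.
have -> : 2 * k.+1 = k.*2.+2 by lia.
by rewrite -[k.+1.-2]/(k.-1) !doubleS in g1 g2 *; lia.
Qed.

(** The inequality fails for k = 3.  By [small_bin_bound] the terms with 3k are at
    most 2/3 'C(4k, 2k), and the ratios of the three binomials with 4k are rational
    in k: what is left is 34 < 4k^2 + 6k. *)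
Lemma bin_margin k : 4 <= k ->
  5 * 'C(4 * k, 2 * k) + 2 * 'C(4 * k, (2 * k).-2) +
    8 * 'C(3 * k, k.+1) + 32 * 'C(3 * k, k.-2) < 8 * 'C(4 * k, (2 * k).-1).
Proof.
move=> k4; have := small_bin_bound k4.
have e1 := mul_bin_left (4 * k) (2 * k).-1; have e2 := mul_bin_left (4 * k) (2 * k).-2.
have E1 : (2 * k).-1.+1 = 2 * k by lia.
have E2 : (2 * k).-2.+1 = (2 * k).-1 by lia.
rewrite E1 in e1; rewrite E2 in e2.
have pos : 0 < 'C(4 * k, (2 * k).-1) by rewrite bin_gt0; lia.
move: 'C(4 * k, 2 * k) 'C(4 * k, (2 * k).-1) 'C(4 * k, (2 * k).-2) e1 e2 pos.
move=> B a b e1 e2 pos bnd.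
suff : 17 * B + 6 * b < 24 * a by lia.
have {}e1 : 2 * k * B = (2 * k + 1) * a by rewrite e1; congr (_ * _); lia.
have {}e2 : (2 * k - 1) * a = (2 * k + 2) * b.
  by rewrite -subn1 in e2; rewrite e2; congr (_ * _); lia.
rewrite -(ltn_pmul2l (_ : 0 < k * (k + 1))); last by lia.
have -> : k * (k + 1) * (17 * B + 6 * b) =
  17 * (k + 1) * (k * B) + 6 * k * ((k + 1) * b) by lia.
nia.
Qed.

(** * Averaging over a weight in a group of order five *)

Section Average.
Variables (T : finType) (M : finZmodType) (w : T -> M) (p : T) (k : nat).
Hypothesis wp : forall x, (w x == w p) = (x == p).
Hypothesis k_gt0 : 0 < k.
Implicit Types (A B C : {set T}) (c v : M) (x y : T).

Definition weight A : M := (\sum_(x in A) w x)%R.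
Definition fiber v : {set T} := [set x | w x == v].
Definition level j : {set {set T}} := [set C : {set T} | (p \in C) && (#|C| == j)].
(** The upper shadow, within the sets through p, of the sets of size 2k - 1 that
    contain p and have weight c. *)
Definition upper_shadow c : {set {set T}} :=
  [set C in level (2 * k) | [exists x in C :\ p, weight (C :\ x) == c]].
Local Notation interior c := (shadow_interior k p (upper_shadow c)).

Lemma weightD1 A x : x \in A -> weight (A :\ x) = (weight A - w x)%R.
Proof. by move=> xA; rewrite /weight (big_setD1 x xA) /= addrAC subrr add0r. Qed.

Lemma weightU1 A x : x \notin A -> weight (x |: A) = (weight A + w x)%R.
Proof. by move=> xA; rewrite /weight big_setU1 //= addrC. Qed.

Lemma interior_level c : interior c \subset level (2 * k).-1.
Proof. by apply/subsetP=> A; rewrite !inE => /and3P[-> ->]. Qed.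

Lemma shadow_interiorP c : {in upper_shadow c, forall C : {set T},
  exists2 x, x \in C & C :\ x \in interior c}.
Proof.
move=> C; rewrite !inE => /andP[/andP[pC /eqP cC] /exists_inP[x]].
rewrite !inE => /andP[xp xC] /eqP wCx; exists x => //.
have pCx : p \in C :\ x by rewrite !inE eq_sym xp.
have cCx : #|C :\ x| = (2 * k).-1 by rewrite -cC (cardsD1 x C) xC.
rewrite !inE pC cCx eq_sym xp eqxx /=; apply/forallP=> y; apply/implyP=> yCx.
rewrite !inE pC [p == x]eq_sym xp orbT cardsU1 yCx cCx /=.
rewrite (_ : 1 + _ == _ = true); last by apply/eqP; lia.
apply/exists_inP; exists y; last by rewrite setU1K // wCx.
by rewrite !inE eqxx andbT; apply: contraNneq yCx => ->.
Qed.

(** Removing from C points of different weights leaves different weights, so C lies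
    in the upper shadow for at least as many c as there are weights on its points
    other than p. *)
Lemma shadow_count C : C \in level (2 * k) ->
  #|M|.-1 <= #|[set c | C \in upper_shadow c]| +
             #|[set v | v != w p & [disjoint C & fiber v]]|.
Proof.
move=> Cl; set S1 := [set c | _]; set S2 := [set v | _ & _].
have im : #|[set w x | x in C :\ p]| <= #|S1|.
  rewrite -(@card_in_imset _ _ (fun v => weight C - v)%R); last first.
    by move=> u v _ _ /addrI/oppr_inj.
  apply/subset_leq_card/subsetP=> c /imsetP[v /imsetP[x xC ->] ->].
  rewrite !inE; rewrite inE in Cl; rewrite Cl; apply/exists_inP; exists x => //.
  by rewrite weightD1 //; case/setD1P: xC.
rewrite -(cardsC1 (w p)) (leq_trans _ (leq_add im (leqnn _))) //.
rewrite (leq_trans _ (leq_card_setU _ _)) // subset_leq_card //.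
apply/subsetP=> v; rewrite !inE => vp; rewrite vp /=.
have [//|] := boolP [disjoint C & fiber v]; first by rewrite orbT.
case/pred0Pn=> x /andP[/= xC]; rewrite inE => /eqP wx; apply/orP; left.
by apply/imsetP; exists x => //; rewrite !inE xC andbT -wp wx.
Qed.

(** Let d be the weight of A minus c.  When A is extended by a point of weight v,
    the point to be removed has weight v + d, so v + d differs from the weight of p;
    and v may be any value other than that weight, since no fiber is contained in A.
    If d were nonzero, taking v = w p - d would be a contradiction. *)
Lemma interior_weight c A : A \in interior c ->
  (forall v, v != w p -> ~~ (fiber v \subset A)) -> c = weight A.
Proof.
move=> AI noF; apply/eqP; rewrite eq_sym -subr_eq0; apply/negPn/negP=> d0.
set d := (weight A - c)%R in d0.
have /noF/subsetPn[x] : (w p - d != w p)%R.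
  by rewrite -subr_eq0 addrAC subrr sub0r oppr_eq0.
rewrite inE => /eqP wx xA; move: AI; rewrite inE => /and3P[pA _ /forallP/(_ x)].
rewrite xA inE => /andP[_ /exists_inP[y]]; rewrite !inE => /andP[yp yxA] /eqP.
rewrite weightD1 ?inE // weightU1 // wx => /eqP; rewrite subr_eq => /eqP eqc.
case/eqP: yp; apply/eqP; rewrite -wp; apply/eqP.
apply: (@addrI _ c); rewrite -eqc /d opprB addrCA addrC; congr (_ + _)%R.
by rewrite addrC subrK.
Qed.

Lemma interior_count A :
  #|[set c | A \in interior c]| <=
    1 + #|M|.-1 * #|[set v | v != w p & fiber v \subset A]|.
Proof.
set S := [set v | _ & _]; have [S0|] := posnP #|S|.
  apply: leq_trans (leq_addr _ 1); rewrite -(cards1 (weight A)).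
  apply/subset_leq_card/subsetP=> c; rewrite !in_set1 in_set => AI.
  apply/eqP/interior_weight => // v vp; apply/negP=> vA.
  by have := cards0_eq S0 => /setP/(_ v); rewrite !inE vp vA.
have := max_card [set c | A \in interior c]; case: #|M| => [|m]; first by lia.
by rewrite /=; nia.
Qed.

Hypotheses (cM : #|M| = 5) (cT : #|T| = (4 * k).+1).
Hypothesis k_gt1 : 1 < k.
Hypothesis card_fiber : forall v, v != w p -> #|fiber v| = k.

Lemma card_level j : #|level j.+1| = 'C(4 * k, j).
Proof.
have := @card_supersets T [set p] [set: T] j (subsetT _).
rewrite cards1 cardsT cT subn1 => <-; apply: eq_card => C.
by rewrite !inE sub1set subsetT.
Qed.

Lemma card_miss v : v != w p ->
  #|[set C in level (2 * k) | [disjoint C & fiber v]]| = 'C(3 * k, (2 * k).-1).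
Proof.
move=> vp; have pv : [set p] \subset ~: fiber v by rewrite sub1set !inE eq_sym.
have := card_supersets (2 * k).-1 pv; have := cardsC (fiber v).
rewrite cards1 cT card_fiber // => cC.
have -> : #|~: fiber v| - 1 = 3 * k by lia.
have -> : 1 + (2 * k).-1 = 2 * k by lia.
move=> <-; apply: eq_card => C.
by rewrite !inE sub1set disjoints_subset -andbA; congr (_ && _); rewrite andbC.
Qed.

Lemma card_full v : v != w p ->
  #|[set A in level (2 * k).-1 | fiber v \subset A]| = 'C(3 * k, k.-2).
Proof.
move=> vp; have := @card_supersets T (p |: fiber v) [set: T] k.-2 (subsetT _).
rewrite cardsT cT cardsU1 inE eq_sym vp card_fiber //=.
have -> : (4 * k).+1 - (1 + k) = 3 * k by lia.
have -> : 1 + k + k.-2 = (2 * k).-1 by lia.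
move=> <-; apply: eq_card => A.
by rewrite !inE subUset sub1set subsetT -!andbA; congr (_ && _); rewrite andbC.
Qed.

Lemma sum_not_wp m : \sum_(v : M | v != w p) m = 4 * m.
Proof. by rewrite sum_nat_const -[#|_|]/#|[pred v | v != w p]| cardC1 cM. Qed.

Lemma sum_card_subfamily (S : M -> {set {set T}}) (L : {set {set T}}) :
  (forall c, S c \subset L) -> \sum_c #|S c| = \sum_(C in L) #|[set c | C \in S c]|.
Proof.
move=> SL; have := double_count xpredT [in L] (fun c C => C \in S c).
rewrite /= => <-; apply: eq_bigr => c _; apply: eq_card => C; rewrite inE.
by have [/(subsetP (SL c))->|_] := boolP (C \in S c); rewrite ?andbF.
Qed.

Lemma sum_card_shadow :
  4 * 'C(4 * k, (2 * k).-1) <= \sum_c #|upper_shadow c| + 4 * 'C(3 * k, (2 * k).-1).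
Proof.
have sub c : upper_shadow c \subset level (2 * k).
  by apply/subsetP=> C; rewrite inE => /andP[].
rewrite (sum_card_subfamily sub) -[X in _ <= _ + X]sum_not_wp.
under [X in _ <= _ + X]eq_bigr => v vp do rewrite -(card_miss vp).
rewrite (double_count (fun v => v != w p) [in level (2 * k)]) -big_split /=.
rewrite mulnC -card_level prednK ?muln_gt0 // -sum_nat_const.
by apply: leq_sum => C Cl; rewrite -[4]/(5.-1) -cM shadow_count.
Qed.

Lemma sum_card_interior :
  \sum_c #|interior c| <= 'C(4 * k, (2 * k).-2) + 16 * 'C(3 * k, k.-2).
Proof.
rewrite (sum_card_subfamily interior_level).
apply: (@leq_trans (\sum_(A in level (2 * k).-1)
   (1 + 4 * #|[set v | v != w p & fiber v \subset A]|))).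
  by apply: leq_sum => A _; rewrite -[4]/(5.-1) -cM interior_count.
rewrite big_split /= sum1_card -big_distrr /= -[16]/(4 * 4) -mulnA.
rewrite -[4 * 'C(_, _)]sum_not_wp -(double_count (fun v => v != w p)
  [in level (2 * k).-1] (fun v A => fiber v \subset A)).
have -> : (2 * k).-1 = (2 * k).-2.+1 by lia.
rewrite card_level leq_add2l leq_mul2l /= leq_sum // => v vp.
by rewrite -(card_full vp) (_ : (2 * k).-1 = (2 * k).-2.+1) //; lia.
Qed.

Lemma exists_good_shadow : 4 <= k ->
  exists c, 2 * #|interior c| + 'C(4 * k, 2 * k) < 2 * #|upper_shadow c|.
Proof.
move=> k4; have [/existsP //|] :=
  boolP [exists c, 2 * #|interior c| + 'C(4 * k, 2 * k) < 2 * #|upper_shadow c|].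
rewrite negb_exists => /forallP bad.
have : 2 * \sum_c #|upper_shadow c| <= 2 * \sum_c #|interior c| + 5 * 'C(4 * k, 2 * k).
  rewrite -cM -sum_nat_const !big_distrr -big_split.
  by apply: leq_sum => c _; rewrite leqNgt bad.
have := bin_margin k4; have := sum_card_shadow; have := sum_card_interior.
have -> : 'C(3 * k, (2 * k).-1) = 'C(3 * k, k.+1).
  by rewrite -bin_sub; [congr 'C(_, _)|]; lia.
lia.
Qed.

Lemma exists_small_maximal_odd_intersecting : 4 <= k ->
  exists2 H : {set {set T}}, maximal_odd_intersecting H & 2 * #|H| < 2 ^ (4 * k).
Proof.
move=> k4; have [c good] := exists_good_shadow k4.
have lev : {in upper_shadow c, forall C : {set T}, p \in C /\ #|C| = 2 * k}.
  by move=> C; rewrite !inE => /andP[/andP[-> /eqP]].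
exists (exchange k p (upper_shadow c)).
  by apply: exchange_maximal => //; apply: shadow_interiorP.
have := card_exchange k_gt0 cT lev; lia.
Qed.

End Average.

Section BlockWeight.
Variables (k : nat) (k_gt0 : 0 < k).
Let n := (4 * k).+1.

(** Blocks of k consecutive indices receive the weights 0, 1, 2 and 3; the last
    index 4k plays the part of p and has weight 4. *)
Definition block_weight (i : 'I_n) : 'Z_5 := inZp (i %/ k).

Lemma block_lt5 (i : 'I_n) : i %/ k < 5.
Proof. by rewrite ltn_divLR //; have := ltn_ord i; rewrite /n; lia. Qed.

Lemma block_weightE (i : 'I_n) : block_weight i = i %/ k :> nat.
Proof. by rewrite /= modn_small ?block_lt5. Qed.

Lemma block_weight_max (i : 'I_n) :
  (block_weight i == block_weight ord_max) = (i == ord_max).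
Proof.
rewrite -[LHS](inj_eq val_inj) -[RHS](inj_eq val_inj) [val _]block_weightE.
rewrite [X in _ == X]block_weightE /= mulnK //.
apply/eqP/eqP => [ik|->]; last by rewrite mulnK.
have := leq_trunc_div i k; have lti : i < (4 * k).+1 := ltn_ord i.
by rewrite ik => le4; apply: anti_leq; rewrite le4 andbT -ltnS.
Qed.

Lemma card_block (v : 'Z_5) : v != block_weight ord_max -> #|fiber block_weight v| = k.
Proof.
move=> vp; have v4 : v < 4.
  move: vp; rewrite -[v == _](inj_eq val_inj) [X in _ != X]block_weightE /= mulnK //.
  by have lt5 : v < 5 := ltn_ord v; rewrite ltn_neqAle -ltnS lt5 andbT.
have lt_n (j : 'I_k) : v * k + j < n by rewrite /n; have := ltn_ord j; nia.
have inj : injective (fun j : 'I_k => Ordinal (lt_n j)).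
  by move=> i j /(congr1 val)/addnI/val_inj.
rewrite -[RHS]card_ord -(card_imset _ inj); apply: eq_card => i; rewrite inE.
rewrite -(inj_eq val_inj) [val _]block_weightE; apply/eqP/imsetP => [iv|[j _ ->]].
  exists (Ordinal (ltn_pmod i k_gt0)) => //; apply: val_inj => /=.
  by rewrite -iv -divn_eq.
by rewrite /= divnMDl // divn_small ?addn0.
Qed.

End BlockWeight.

Local Close Scope nat_scope.

(** * The subalgebra spanned by an odd intersecting family *)

Section Monomial.
Variables (F : fieldType) (n : nat).
Local Notation G := (grassmann F n).
Implicit Types (S T B : {set 'I_n}) (x y : G).

Lemma gsignC S T : gsign F T S = (-1) ^+ (#|S| * #|T|) * gsign F S T.
Proof.
have gsign1C i j : gsign1 F j i = - gsign1 F i j.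
  rewrite /gsign1 eq_sym; case: eqVneq => [|neij]; first by rewrite oppr0.
  by rewrite -val_eqE in neij; case: ltngtP neij => //=; rewrite expr1 ?opprK.
rewrite /gsign exchange_big mulnC exprM -prodr_const -big_split /=.
by apply: eq_bigr => i _; rewrite -prodrN; apply: eq_bigr => j _.
Qed.

Lemma gsign_neq0 S T : [disjoint S & T] -> gsign F S T != 0.
Proof.
move=> dST; apply/prodf_neq0 => i iS; apply/prodf_neq0 => j jT.
rewrite /gsign1; case: (eqVneq i j) jT => [<-|_ _]; last by rewrite signr_eq0.
by rewrite (disjointFr dST iS).
Qed.

Lemma setU_disjointI S T B : [disjoint S & B] -> [disjoint T & B] ->
  S :|: B = T :|: B -> S = T.
Proof.
move=> dSB dTB /setP eqU; apply/setP=> i; have:= eqU i; rewrite !inE.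
by have [iB|_] := boolP (i \in B); rewrite ?orbF // !(disjointFl _ iB).
Qed.

Lemma coef_gbaseM T B S : [disjoint S & B] ->
  (gbase F T * gbase F B) (S :|: B) = (T == S)%:R * gsign F S B.
Proof.
move=> dSB; rewrite gbaseM !ffunE /GRing.scale /=.
have [-> | neTS] := eqVneq T S; first by rewrite eqxx mulr1 mul1r.
rewrite mul0r; have [dTB | /pred0Pn[i /andP[/= iT iB]]] := boolP [disjoint T & B].
  case: eqVneq => [/(setU_disjointI dSB dTB) eqST|_]; last by rewrite mulr0.
  by rewrite eqST eqxx in neTS.
by rewrite (gsign_disj _ iT iB) mul0r.
Qed.

(** Among the products of monomials of x with v_B, only that of v_S is a multiple of
    v_(S :|: B), because S is recovered from S :|: B. *)
Lemma coef_mul_gbase x S B : [disjoint S & B] ->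
  (x * gbase F B) (S :|: B) = x S * gsign F S B.
Proof.
move=> dSB; rewrite {1}[x]gbase_sum mulr_suml sum_ffunE (bigD1 S) //= big1 => [|T neTS].
  by rewrite -scalerAl ffunE coef_gbaseM // eqxx mul1r addr0.
by rewrite -scalerAl ffunE coef_gbaseM // (negbTE neTS) mul0r scaler0.
Qed.

Lemma coef_gbase_mul x S B : [disjoint S & B] ->
  (gbase F B * x) (S :|: B) = x S * gsign F B S.
Proof.
move=> dSB; rewrite {1}[x]gbase_sum mulr_sumr sum_ffunE (bigD1 S) //= big1 => [|T neTS].
  by rewrite -scalerAr ffunE gbaseM setUC !ffunE eqxx /GRing.scale /= mulr1 addr0.
have gC : gbase F B * gbase F T = (-1) ^+ (#|T| * #|B|) *: (gbase F T * gbase F B).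
  by rewrite !gbaseM scalerA gsignC setUC.
by rewrite -scalerAr gC !ffunE coef_gbaseM // (negbTE neTS) mul0r !scaler0.
Qed.

Definition monomial_span (H : {set {set 'I_n}}) : {vspace G} :=
  <<[seq gbase F T | T in H]>>%VS.

Lemma gbase_monomial_span (H : {set {set 'I_n}}) S :
  S \in H -> gbase F S \in monomial_span H.
Proof. by move=> SH; apply/memv_span/map_f; rewrite mem_enum. Qed.

Lemma monomial_spanP (H : {set {set 'I_n}}) x :
  reflect (forall S, S \notin H -> x S = 0) (x \in monomial_span H).
Proof.
apply: (iffP idP) => [xH S SH|xH]; last first.
  rewrite [x]gbase_sum; apply: memv_suml => S _.
  have [SH|/xH->] := boolP (S \in H); last by rewrite scale0r mem0v.
  by apply/memvZ/gbase_monomial_span.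
rewrite (coord_span (xH : x \in <<in_tuple _>>%VS)) sum_ffunE big1 // => i _.
rewrite !ffunE; have /mapP[T TH ->] : (in_tuple [seq gbase F T | T in H])`_i
    \in [seq gbase F T | T in H] by apply: mem_nth; have:= ltn_ord i.
rewrite ffunE; case: eqVneq SH => [->|_ _]; last by rewrite /GRing.scale /= mulr0.
by rewrite -mem_enum TH.
Qed.

Lemma dim_monomial_span H : (\dim (monomial_span H) <= #|H|)%N.
Proof. by rewrite (leq_trans (dim_span _)) // size_map -cardE. Qed.

Lemma gbase_comm S T : ~~ odd #|S| -> gbase F S * gbase F T = gbase F T * gbase F S.
Proof.
by move=> evS; rewrite !gbaseM setUC (gsignC S T) -signr_odd oddM (negbTE evS) mul1r.
Qed.

End Monomial.

Section Maximal.
Variables (F : fieldType) (F2 : 2%N \notin [pchar F]) (n : nat).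
Variable H : {set {set 'I_n}}.
Hypothesis maxH : maximal_odd_intersecting H.
Local Notation G := (grassmann F n).
Implicit Types (S T B : {set 'I_n}) (x y : G).
Let K := evens 'I_n :|: H.
Let U : {vspace G} := monomial_span F K.

(** A family to which no odd set can be added contains the odd supersets of its
    members; this is what makes the span closed under multiplication by even
    elements. *)
Lemma maximal_odd_intersecting_setU S T :
  S \in H -> [disjoint S & T] -> ~~ odd #|T| -> S :|: T \in H.
Proof.
case: maxH => oddH meetH domH SH dST evT; apply/negPn/negP=> STH.
have [|//|B BH dSTB] := domH (S :|: T).
  by move: dST; rewrite cardsU disjoint_sym -setI_eq0 setIC => /eqP->;
     rewrite cards0 subn0 oddD (negbTE evT) oddH.
by have:= meetH S B SH BH; rewrite (disjointWl _ dSTB) // subsetUl.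
Qed.

Lemma gbaseM_eq0 S T : S \in H -> T \in H -> gbase F S * gbase F T = 0.
Proof.
case: maxH => _ meetH _ SH TH; have /pred0Pn[i /andP[/= iS iT]] := meetH S T SH TH.
by rewrite gbaseM (gsign_disj _ iS iT) scale0r.
Qed.

Lemma gbaseM_span S T : S \in K -> T \in K -> gbase F S * gbase F T \in U.
Proof.
have evM (X Y : {set 'I_n}) : ~~ odd #|X| -> Y \in K -> gbase F X * gbase F Y \in U.
  move=> evX YK; have [dXY|] := boolP [disjoint X & Y]; last first.
    case/pred0Pn=> i /andP[/= iX iY].
    by rewrite gbaseM (gsign_disj _ iX iY) scale0r mem0v.
  rewrite gbaseM memvZ // gbase_monomial_span //.
  move: YK; rewrite !inE => /orP[evY|YH].
    by rewrite cardsU (disjoint_setI0 dXY) cards0 subn0 oddD (negbTE evX) (negbTE evY).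
  by rewrite setUC maximal_odd_intersecting_setU ?orbT // disjoint_sym.
move=> SK TK; have [evS|oddS] := boolP (~~ odd #|S|); first exact: evM.
have [evT|oddT] := boolP (~~ odd #|T|); first by rewrite -gbase_comm ?evM.
move: SK TK; rewrite !inE (negbTE oddS) (negbTE oddT) /= => SH TH.
by rewrite gbaseM_eq0 ?mem0v.
Qed.

Lemma span_is_aspace : is_aspace U.
Proof.
rewrite /is_aspace has_algid1; last first.
  by apply: gbase_monomial_span; rewrite !inE cards0.
apply/prodvP=> x y xU yU; rewrite [x]gbase_sum [y]gbase_sum mulr_suml memv_suml // => S _.
have [SK|SK] := boolP (S \in K); last first.
  by rewrite (monomial_spanP _ _ xU) // scale0r mul0r mem0v.
rewrite mulr_sumr memv_suml // => T _; have [TK|TK] := boolP (T \in K); last first.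
  by rewrite (monomial_spanP _ _ yU) // scale0r mulr0 mem0v.
by rewrite -scalerAl -scalerAr !memvZ // gbaseM_span.
Qed.

Definition span_aspace : {aspace G} := ASpace span_is_aspace.

Lemma span_comm : {in U &, commutative *%R}.
Proof.
move=> x y xU yU; rewrite [x]gbase_sum [y]gbase_sum mulr_suml mulr_sumr.
apply: eq_bigr => S _; rewrite mulr_sumr mulr_suml; apply: eq_bigr => T _.
have [SK|SK] := boolP (S \in K); last first.
  by rewrite (monomial_spanP _ _ xU) // !scale0r mulr0 mul0r.
have [TK|TK] := boolP (T \in K); last first.
  by rewrite (monomial_spanP _ _ yU) // !scale0r mulr0 mul0r.
rewrite -!scalerAl -!scalerAr scalerA [in RHS]scalerA mulrC; congr (_ *: _).
have [evS|oddS] := boolP (~~ odd #|S|); first exact: gbase_comm.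
have [evT|oddT] := boolP (~~ odd #|T|); first by rewrite -gbase_comm.
move: SK TK; rewrite !inE (negbTE oddS) (negbTE oddT) /= => SH TH.
by rewrite !gbaseM_eq0.
Qed.

(** If x commutes with v_B, B odd, and S is odd and disjoint from B, comparing the
    coefficients of v_(S :|: B) in x v_B and v_B x shows that twice the coefficient
    of v_S in x is 0. *)
Lemma span_maximal : maximal_commutative span_aspace.
Proof.
split=> [|W commW UW]; first exact: span_comm.
apply/eqP; rewrite eqEsubv UW andbT; apply/subvP=> x xW; apply/monomial_spanP=> S.
rewrite !inE negb_or negbK => /andP[oddS SH].
case: maxH => oddH _ /(_ S oddS SH)[B BH dSB].
have BW : gbase F B \in W.
  by apply: (subvP UW); apply: gbase_monomial_span; rewrite !inE BH orbT.
have /ffunP/(_ (S :|: B)) := commW _ _ xW BW.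
rewrite coef_mul_gbase // coef_gbase_mul // (gsignC F S B) -signr_odd oddM oddS oddH //.
rewrite mulN1r mulrN => /eqP; rewrite -addr_eq0 -mulr2n -mulr_natr !mulf_eq0.
rewrite (negbTE (gsign_neq0 F dSB)) orbF; case/orP=> [/eqP//|/eqP two0].
by move: F2; rewrite inE /= two0 eqxx.
Qed.

End Maximal.

(** * Transport to an arbitrary presentation *)

Section Transport.
Variable F : fieldType.

Lemma limg_is_aspace (A B : falgType F) (f : {lrmorphism A -> B}) (U : {aspace A}) :
  injective f -> is_aspace (linfun f @: U)%VS.
Proof.
move=> f_inj; rewrite /is_aspace -(aimgM (linfun_ahom f)) limgS ?andbT; last first.
  by case/andP: (valP U).
apply/has_algidP; exists (f (algid U)); split.
- by rewrite -[f _]lfunE memv_img ?memv_algid.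
- by rewrite -(rmorph0 f) (inj_eq f_inj) algid_neq0.
by move=> _ /memv_imgP[u uU ->]; rewrite lfunE -!rmorphM algidl ?algidr.
Qed.

Lemma maximal_commutative_iso (A B : falgType F) (f : {lrmorphism A -> B})
    (g : {lrmorphism B -> A}) (fK : cancel f g) (gK : cancel g f) (U : {aspace A}) :
  maximal_commutative U ->
  exists2 V : {aspace B}, maximal_commutative V & (\dim V = \dim U)%N.
Proof.
case=> commU maxU; have f_inj := can_inj fK; have g_inj := can_inj gK.
exists (ASpace (limg_is_aspace U f_inj)); last first.
  rewrite /= limg_dim_eq // [lker _](eqP (_ : lker _ == 0%VS)) ?capv0 //.
  by apply/lker0P=> x y; rewrite !lfunE; apply: f_inj.
split=> [_ _ /memv_imgP[x xU ->] /memv_imgP[y yU ->]|W commW UW].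
  by rewrite !lfunE -!rmorphM /= commU.
have maxg : (linfun g @: W)%VS = U :> {vspace A}.
  apply: (maxU (ASpace (limg_is_aspace W g_inj))) => /=.
    move=> _ _ /memv_imgP[x xW ->] /memv_imgP[y yW ->].
    by rewrite !lfunE -!rmorphM /= commW.
  apply/subvP=> u uU; rewrite -[u]fK -[g _]lfunE memv_img //.
  by rewrite (subvP UW) // -[f u]lfunE memv_img.
rewrite /= -maxg; apply/eqP; rewrite eqEsubv; apply/andP; split; apply/subvP=> x.
  by move=> xW; rewrite -[x]gK -[g x]lfunE -[f _]lfunE !memv_img.
by case/memv_imgP=> _ /memv_imgP[y yW ->] ->; rewrite !lfunE /= gK.
Qed.

Lemma is_grassmann_iso (n : nat) (A B : falgType F) (v : 'I_n -> A) (w : 'I_n -> B) :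
  is_grassmann v -> is_grassmann w ->
  exists (f : {lrmorphism A -> B}) (g : {lrmorphism B -> A}), cancel f g /\ cancel g f.
Proof.
move=> [v_anti v_univ] [w_anti w_univ].
have [f [fv _]] := v_univ B w w_anti; have [g [gw _]] := w_univ A v v_anti.
have [idA [_ uniqA]] := v_univ A v v_anti; have [idB [_ uniqB]] := w_univ B w w_anti.
exists f, g; split=> x.
  have /= -> := uniqA (g \o f : {lrmorphism A -> A})
    (fun i => etrans (congr1 g (fv i)) (gw i)) x.
  by have /= <- := uniqA (idfun : {lrmorphism A -> A}) (fun i => erefl _) x.
have /= -> := uniqB (f \o g : {lrmorphism B -> B})
  (fun i => etrans (congr1 f (gw i)) (fv i)) x.
by have /= <- := uniqB (idfun : {lrmorphism B -> B}) (fun i => erefl _) x.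
Qed.

End Transport.

Theorem corollary4 (F : fieldType) (F2 : 2%N \notin [pchar F])
    (n k : nat) (nk : n = (4 * k + 1)%N) (n_bounds : (17 <= n < 1000)%N)
    (G : falgType F) (v : 'I_n -> G) (Gv : is_grassmann v) :
  exists U : {aspace G},
    maximal_commutative U /\ (\dim U < 3 * 2 ^ (n - 2))%N.
Proof.
rewrite addn1 in nk; have k4 : (4 <= k)%N by lia.
have k_gt0 : (0 < k)%N by lia.
have k_gt1 : (1 < k)%N by lia.
subst n.
have [H maxH cH] := exists_small_maximal_odd_intersecting (block_weight_max k_gt0)
  k_gt0 (card_ord 5) (card_ord _) k_gt1 (card_block k_gt0) k4.
have [f [g [fK gK]]] := is_grassmann_iso (ggen_is_grassmann (4 * k).+1 F2) Gv.
have [U maxU dimU] := maximal_commutative_iso fK gK (span_maximal F2 maxH).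
exists U; split=> //; rewrite dimU.
have le_dim := dim_monomial_span F (evens 'I_(4 * k).+1 :|: H).
have cE : (#|evens 'I_(4 * k).+1| <= 2 ^ (4 * k))%N.
  by have := card_evens (ord_max : 'I_(4 * k).+1); rewrite card_ord.
have cEH := leq_card_setU (evens 'I_(4 * k).+1) H.
have pow2 : (2 ^ (4 * k) = 2 * 2 ^ ((4 * k).+1 - 2))%N.
  by rewrite -expnS; congr (2 ^ _)%N; lia.
rewrite pow2 in cE cH; apply: leq_ltn_trans (leq_trans le_dim cEH) _.
by rewrite (mulnDl 2 1) mul1n -addnS leq_add // -(ltn_pmul2l (isT : 0 < 2)%N).
Qed.
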